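(* Let $n=4$, let $m^{(3)}=(m_1,m_2,m_3)$ be I-realizable on $\mathbb{N}_0$, let $\nu$ (with support $\{y_1,y_2\}$, $y_1<y_2$) and $\mu$ be the measures associated with $m^{(3)}$ as defined in the context, and suppose that $\operatorname{supp}\nu\not\subset\mathbb{N}_0$. Put $Y_j=\lfloor y_j\rfloor$ for $j=1,2$, and $$t_1=\frac{m_3-(2Y_2+1)m_2+Y_2(Y_2+1)m_1}{m_2-(2Y_2+1)m_1+Y_2(Y_2+1)},\quad T_1=\lfloor t_1\rfloor,$$ $$t_2=\frac{m_3-(2Y_1+1)m_2+Y_1(Y_1+1)m_1}{m_2-(2Y_1+1)m_1+Y_1(Y_1+1)},\quad T_2=\lfloor t_2\rfloor.$$ Then $\operatorname{supp}\mu\subset\{T_1,T_1+1,T_2,T_2+1\}$ with $|\operatorname{supp}\mu|\ge3$; moreover $T_2\ge T_1+1$, so that if $T_2>T_1+1$ then $$(x-T_1)(x-T_1-1)(x-T_2)(x-T_2-1)$$ is a minimizing polynomial $P_4^{(m)}$, and if $T_2=T_1+1$ then, for example, $$(x-T_1)(x-T_2)(x-T_2-1)(x-T_2-2)$$ is a minimizing polynomial $P_4^{(m)}$.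
   Context: $\mathbb{N}_0=\{0,1,2,\dots\}$, $\mathbb{R}_+=[0,\infty)$. A moment vector $m=m^{(n)}=(m_1,\dots,m_n)$ is an $n$-tuple of real numbers; $m_0=1$, $m^{(j)}=(m_1,\dots,m_j)$. It is realizable on $\mathbb{X}\subset\mathbb{R}$ if there is a probability measure on $\mathbb{X}$ whose $k$-th moment is $m_k$ for $k=1,\dots,n$. For $P(x)=\sum_{k=0}^n p_kx^k$, $L_P(m)=\sum_{k=0}^n p_km_k$. For $k\ge 0$, $\mathcal{P}_k$ is the set of monic polynomials of degree $k$ with $k$ distinct roots in $\mathbb{N}_0$ which are nonnegative on $\mathbb{N}_0$ ($\mathcal{P}_0=\{1\}$). A moment vector $m^{(n)}$ realizable on $\mathbb{N}_0$ is I-realizable on $\mathbb{N}_0$ if $L_P(m)>0$ for all $P\in\mathcal{P}_n\cup\mathcal{P}_{n-1}$. A minimizing polynomial $P_n^{(m)}$ for $m^{(n)}$ is an element of $\mathcal{P}_n$ minimizing $L_P(m)$ over $P\in\mathcal{P}_n$; this property does not depend on $m_n$. Given $m^{(3)}$ I-realizable on $\mathbb{N}_0$: let $\widehat m_4$ be the smallest real value such that the Hankel matrix $(m_{i+j})_{i,j=0}^2$ with $m_4=\widehat m_4$ is positive semidefinite. Then $(m_1,m_2,m_3,\widehat m_4)$ is realized on $\mathbb{R}_+$ by a unique probability measure $\nu$; it has exactly two support points $0<y_1<y_2$. Let $\widetilde m_4$ be the smallest real value for which $(m_1,m_2,m_3,\widetilde m_4)$ is realizable on $\mathbb{N}_0$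 (equivalently $L_{P_4^{(m)}}(m_1,m_2,m_3,\widetilde m_4)=0$); it is realized on $\mathbb{N}_0$ by a unique probability measure, denoted $\mu$. *)

(* Defs.v *)
From HB Require Import structures.
From mathcomp Require Import all_boot all_order all_algebra.
From mathcomp Require Import all_classical all_reals all_analysis.

Set Implicit Arguments.
Unset Strict Implicit.
Unset Printing Implicit Defensive.

Import Order.TTheory GRing.Theory Num.Theory.
Import numFieldNormedType.Exports.

Local Open Scope classical_set_scope.
Local Open Scope ring_scope.

Definition N0 {R : realType} : set R := [set x | exists k : nat, x = k%:R].

Definition Rplus {R : realType} : set R := [set x | 0 <= x].

Definition is_smallest {R : realType} (E : set R) (x : R) : Prop :=
  E x /\ lbound E x.

(* A moment vector (m_1, ..., m_n) is an n-tuple, so m_(k+1) is [tnth m k];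
   [mom m k] is m_k, with m_0 = 1. *)
Definition mom {R : realType} (n : nat) (m : n.-tuple R) (k : nat) : R :=
  nth 0 (1 :: m) k.

Definition realizes {R : realType} (X : set R)
    (mu : probability (measurableTypeR R) R) (n : nat) (m : n.-tuple R) : Prop :=
  {ae mu, forall x, X x} /\
  forall k : 'I_n,
    mu.-integrable setT (fun x : R => (x ^+ k.+1)%:E) /\
    (\int[mu]_x (x ^+ k.+1)%:E = (tnth m k)%:E)%E.

Definition realizable {R : realType} (X : set R) (n : nat) (m : n.-tuple R)
  : Prop := exists mu : probability (measurableTypeR R) R, realizes X mu m.

(* L_P(m); meaningful for deg P <= n. *)
Definition Lfun {R : realType} (n : nat) (P : {poly R}) (m : n.-tuple R) : R :=
  \sum_(k < n.+1) P`_k * mom m k.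

Definition calP {R : realType} (k : nat) (P : {poly R}) : Prop :=
  [/\ P \is monic,
      size P = k.+1,
      exists s : seq nat,
        [/\ uniq s, size s = k & all (fun a : nat => root P a%:R) s]
    & forall j : nat, 0 <= P.[j%:R]].

(* Used for n >= 1 only, so that n.-1 is the genuine predecessor. *)
Definition I_realizable {R : realType} (n : nat) (m : n.-tuple R) : Prop :=
  realizable N0 m /\
  forall P : {poly R}, calP n P \/ calP n.-1 P -> 0 < Lfun P m.

Definition minimizing_poly {R : realType} (n : nat) (m : n.-tuple R)
    (P : {poly R}) : Prop :=
  calP n P /\ forall Q : {poly R}, calP n Q -> Lfun P m <= Lfun Q m.

Definition hankel {R : realType} (d n : nat) (m : n.-tuple R) : 'M[R]_d.+1 :=
  \matrix_(i, j) mom m (i + j)%N.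

Definition psd {R : realType} (d : nat) (A : 'M[R]_d) : Prop :=
  A^T = A /\ forall v : 'cV[R]_d, 0 <= (v^T *m A *m v) 0 0.

Definition supp {R : realType} (mu : probability (measurableTypeR R) R)
  : set R :=
  [set x | forall U : set R, open U -> U x -> (0 < mu U)%E].

(* Main.v *)
Require Import Defs.
From HB Require Import structures.
From mathcomp Require Import all_boot all_order all_algebra.
From mathcomp Require Import all_classical all_reals all_analysis.
From mathcomp Require Import measurable_realfun ring lra zify.

Set Implicit Arguments.
Unset Strict Implicit.
Unset Printing Implicit Defensive.

Import Order.TTheory GRing.Theory Num.Theory.
Import numFieldNormedType.Exports.

Local Open Scope classical_set_scope.
Local Open Scope ring_scope.

(** With [E x y z] the value of the moment functional at (X - x)(X - y)(X - z),
    [t_1] is the zero of [E _ Y_2 (Y_2 + 1)] and [t_2] that of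
    [E Y_1 (Y_1 + 1) _].  Evaluating [E] on the two atoms of [nu] gives
    [t_1 <= y_1 < y_2 <= t_2] and shows that at least one of [T_1 = Y_1],
    [T_2 = Y_2] holds; in either case the Lagrange weights of the four nodes
    [T_1], [T_1 + 1], [T_2], [T_2 + 1] come out nonnegative.  These weights
    define a measure on the naturals with moments [m_1], [m_2], [m_3] that
    annihilates the quartic with these four roots.  As this quartic is
    nonnegative on the naturals, its integral against any realizing measure is
    minimal exactly when it vanishes, so [mu] lives on the four nodes and the
    quartic is minimizing.  If [mu] had at most two atoms [u], [v], then
    (X - u)(X - v) would be orthogonal to the affine functions, so it would
    vanish at [y_1] and [y_2], which would then be natural numbers.  The same
    sign conditions exclude [T_2 = T_1 + 1]. *)

(* The moment functional at (X - x)(X - y)(X - z). *)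
Definition cubic_moment {F : comNzRingType} (m1 m2 m3 x y z : F) : F :=
  m3 - (x + y + z) * m2 + (x * y + y * z + x * z) * m1 - x * y * z.

(** * Signs of cubic moments of a two-atom measure *)

Section floor_nodes.
Variables (F : realFieldType) (p1 p2 y1 y2 m1 m2 m3 t1 t2 : F).
Variables (Y1 Y2 T1 T2 : int).
Hypotheses (p1_gt0 : 0 < p1) (p2_gt0 : 0 < p2) (p12 : p1 + p2 = 1).
Hypothesis y12 : y1 < y2.
Hypotheses (m1E : m1 = p1 * y1 + p2 * y2)
  (m2E : m2 = p1 * y1 ^+ 2 + p2 * y2 ^+ 2)
  (m3E : m3 = p1 * y1 ^+ 3 + p2 * y2 ^+ 3).
Hypotheses (Y1y : Y1%:~R <= y1 < Y1%:~R + 1) (Y2y : Y2%:~R <= y2 < Y2%:~R + 1).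
Hypotheses (T1t : T1%:~R <= t1 < T1%:~R + 1) (T2t : T2%:~R <= t2 < T2%:~R + 1).

Local Notation E := (cubic_moment m1 m2 m3).
(** The moment functional at (X - k)(X - (k + 1)); the denominators of [t1] and [t2] are its values
    at [Y2] and [Y1]. *)
Let D (k : F) := m2 - (2 * k + 1) * m1 + k * (k + 1).

Hypotheses (D1_gt0 : 0 < D Y1%:~R) (D2_gt0 : 0 < D Y2%:~R).
Hypotheses
  (t1E : t1 * D Y2%:~R = m3 - (2 * Y2%:~R + 1) * m2 + Y2%:~R * (Y2%:~R + 1) * m1)
  (t2E : t2 * D Y1%:~R = m3 - (2 * Y1%:~R + 1) * m2 + Y1%:~R * (Y1%:~R + 1) * m1).

Let p1_ge0 : 0 <= p1. Proof. exact: ltW. Qed.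
Let p2_ge0 : 0 <= p2. Proof. exact: ltW. Qed.

Let EE x y z : E x y z = p1 * ((y1 - x) * (y1 - y) * (y1 - z))
                       + p2 * ((y2 - x) * (y2 - y) * (y2 - z)).
Proof.
rewrite /cubic_moment m1E m2E m3E.
have -> : p2 = 1 - p1 by rewrite -p12 addrC addKr.
by ring.
Qed.

Let DE k : D k = p1 * ((y1 - k) * (y1 - (k + 1)))
               + p2 * ((y2 - k) * (y2 - (k + 1))).
Proof.
rewrite /D m1E m2E; have -> : p2 = 1 - p1 by rewrite -p12 addrC addKr.
by ring.
Qed.

(** A cubic moment is affine in each root, with slope minus the moment of the remaining quadratic
    factor; so its sign is read off from the position of [z] relative to [t1]. *)
Let Et1 z : E z Y2%:~R (Y2%:~R + 1) = (t1 - z) * D Y2%:~R.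
Proof. by rewrite mulrBl t1E /cubic_moment /D; ring. Qed.

Let Et2 z : E Y1%:~R (Y1%:~R + 1) z = (t2 - z) * D Y1%:~R.
Proof. by rewrite mulrBl t2E /cubic_moment /D; ring. Qed.

Let ltz1 (a b : int) (x y : F) :
  a%:~R <= x -> x <= y -> y < b%:~R + 1 -> (a <= b)%R.
Proof.
move=> ax xy yb; rewrite -ltzD1 -(ltr_int F) intrD.
exact: le_lt_trans ax (le_lt_trans xy yb).
Qed.

Let stepz (a b : int) : (a < b)%R -> a%:~R + 1 <= b%:~R :> F.
Proof. by rewrite -lezD1 -(ler_int F) intrD. Qed.

(** With equal floors both atoms would lie in [Y1, Y1 + 1), where (X - Y1)(X - Y1 - 1) is
    nonpositive, against [D1_gt0]. *)
Lemma floor_nodes_sep : Y1%:~R + 1 <= Y2%:~R :> F.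
Proof.
move: Y1y Y2y => /andP[a1 a2] /andP[b1 b2].
apply: stepz; rewrite lt_neqAle (ltz1 a1 (ltW y12) b2) andbT.
apply/eqP => Y12; move: D1_gt0; rewrite ltNge => /negP; apply.
rewrite DE -oppr_ge0.
have -> : - (p1 * ((y1 - Y1%:~R) * (y1 - (Y1%:~R + 1)))
           + p2 * ((y2 - Y1%:~R) * (y2 - (Y1%:~R + 1))))
  = p1 * ((y1 - Y1%:~R) * (Y1%:~R + 1 - y1))
           + p2 * ((y2 - Y1%:~R) * (Y1%:~R + 1 - y2)) by ring.
rewrite -Y12 in b1 b2.
by rewrite addr_ge0// ?mulr_ge0//; lra.
Qed.

(** At [z = y1] the atom [y1] drops out of [Et1], and the cubic is nonpositive at [y2], which lies
    between [Y2] and [Y2 + 1]. *)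
Let t1_le : t1 <= y1.
Proof.
move: Y1y Y2y floor_nodes_sep => /andP[a1 a2] /andP[b1 b2] c.
rewrite -subr_le0 -(pmulr_lle0 _ D2_gt0) -Et1 EE subrr !mul0r mulr0 add0r -oppr_ge0.
have -> : - (p2 * ((y2 - y1) * (y2 - Y2%:~R) * (y2 - (Y2%:~R + 1))))
  = p2 * ((y2 - y1) * (y2 - Y2%:~R) * (Y2%:~R + 1 - y2)) by ring.
by rewrite !mulr_ge0//; lra.
Qed.

(** At [z = y2] the atom [y2] drops out of [Et2], and the cubic is nonnegative at [y1]. *)
Let t2_ge : y2 <= t2.
Proof.
move: Y1y Y2y floor_nodes_sep => /andP[a1 a2] /andP[b1 b2] c.
rewrite -subr_ge0 -(pmulr_lge0 _ D1_gt0) -Et2 EE subrr !mulr0 addr0.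
have -> : p1 * ((y1 - Y1%:~R) * (y1 - (Y1%:~R + 1)) * (y1 - y2))
  = p1 * ((y1 - Y1%:~R) * ((Y1%:~R + 1) - y1) * (y2 - y1)) by ring.
by rewrite !mulr_ge0//; lra.
Qed.

Let T1_le : (T1 <= Y1)%R.
Proof. by case/andP: T1t Y1y => ? _ /andP[_ ?]; exact: ltz1 t1_le _. Qed.

Let T2_ge : (Y2 <= T2)%R.
Proof. by case/andP: T2t Y2y => _ ? /andP[? _]; exact: ltz1 t2_ge _. Qed.

(* At most one of the two nodes moves: [t1 < Y1] forces
   [E Y1 Y2 (Y2 + 1) < 0] while [Y2 + 1 <= t2] forces
   [0 <= E Y1 (Y1 + 1) (Y2 + 1)], and the former moment is the larger one. *)
Let fixed_node : T1 = Y1 \/ T2 = Y2.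
Proof.
move: Y1y Y2y floor_nodes_sep T1t T2t
  => /andP[a1 a2] /andP[b1 b2] c /andP[s1 s2] /andP[u1 u2].
have [->|T1Y1] := eqVneq T1 Y1; first by left.
have [->|T2Y2] := eqVneq T2 Y2; first by right.
have {}T1Y1 : T1%:~R + 1 <= Y1%:~R :> F by apply: stepz; rewrite lt_neqAle T1Y1.
have {}T2Y2 : Y2%:~R + 1 <= T2%:~R :> F.
  by apply: stepz; rewrite lt_neqAle eq_sym T2Y2.
have : E Y1%:~R Y2%:~R (Y2%:~R + 1) < 0.
  by rewrite Et1 nmulr_rlt0//; lra.
have : 0 <= E Y1%:~R (Y1%:~R + 1) (Y2%:~R + 1).
  by rewrite Et2 mulr_ge0 ?(ltW D1_gt0)//; lra.
suff : 0 <= E Y1%:~R Y2%:~R (Y2%:~R + 1) - E Y1%:~R (Y1%:~R + 1) (Y2%:~R + 1).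
  by move=> ? ? ?; exfalso; lra.
rewrite !EE.
set l := (X in 0 <= X).
(* The two cubics share the roots [Y1] and [Y2 + 1], and both atoms lie between these. *)
have -> : l = (p1 * ((y1 - Y1%:~R) * (Y2%:~R + 1 - y1)) +
   p2 * ((y2 - Y1%:~R) * (Y2%:~R + 1 - y2))) * (Y2%:~R - (Y1%:~R + 1)).
  by rewrite /l; ring.
apply: mulr_ge0; last lra.
by apply: addr_ge0; rewrite !mulr_ge0//; lra.
Qed.

(** The floors already give [T1 + 1 <= T2]. Equality would force [T1 = Y1] and [T2 = Y2 = Y1 + 1],
    and then [Et1] and [Et2] would give contradictory signs to one and the same cubic moment. *)
Lemma floor_nodes_gap : T1%:~R + 2 <= T2%:~R :> F.
Proof.
move: Y1y Y2y floor_nodes_sep T1t T2t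
  => /andP[a1 a2] /andP[b1 b2] c /andP[s1 s2] /andP[u1 u2].
have T1Y1 : T1%:~R <= Y1%:~R :> F by rewrite ler_int.
have T2Y2 : Y2%:~R <= T2%:~R :> F by rewrite ler_int.
suff : (T1 + 1 < T2)%R by move/stepz; rewrite intrD; lra.
rewrite -(ltr_int F) intrD lt_neqAle; apply/andP; split; last by lra.
apply/eqP => T12.
have [T1E T2E] : T1 = Y1 /\ T2 = Y2.
  by split; apply: (@intr_inj F); lra.
have : E Y1%:~R (Y1%:~R + 1) (T2%:~R + 1) < 0 by rewrite Et2 nmulr_rlt0//; lra.
have : 0 <= E T1%:~R Y2%:~R (Y2%:~R + 1).
  by rewrite Et1 mulr_ge0 ?(ltW D2_gt0)//; lra.
rewrite -T1E T12 T2E; lra.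
Qed.

(** Up to denominators of alternating sign, these are the Lagrange weights of the four nodes. By
    [fixed_node] one pair of nodes starts at the floor of an atom, so [Et1] or [Et2] settles two
    signs; the other two need an argument when the other pair has moved. *)
Lemma floor_nodes_sign :
  [/\ E (T1%:~R + 1) T2%:~R (T2%:~R + 1) <= 0,
      0 <= E T1%:~R T2%:~R (T2%:~R + 1),
      E T1%:~R (T1%:~R + 1) (T2%:~R + 1) <= 0
    & 0 <= E T1%:~R (T1%:~R + 1) T2%:~R].
Proof.
move: Y1y Y2y floor_nodes_sep T1t T2t
  => /andP[a1 a2] /andP[b1 b2] c /andP[s1 s2] /andP[u1 u2].
have T1Y1 : T1%:~R <= Y1%:~R :> F by rewrite ler_int.
have T2Y2 : Y2%:~R <= T2%:~R :> F by rewrite ler_int.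
have gap := floor_nodes_gap.
have F1 : 0 <= E T1%:~R Y2%:~R (Y2%:~R + 1).
  by rewrite Et1 mulr_ge0 ?(ltW D2_gt0)//; lra.
have F2 : E (T1%:~R + 1) Y2%:~R (Y2%:~R + 1) <= 0.
  by rewrite Et1 nmulr_rle0 ?(ltW D2_gt0)//; lra.
have F3 : 0 <= E Y1%:~R (Y1%:~R + 1) T2%:~R.
  by rewrite Et2 mulr_ge0 ?(ltW D1_gt0)//; lra.
have F4 : E Y1%:~R (Y1%:~R + 1) (T2%:~R + 1) <= 0.
  by rewrite Et2 nmulr_rle0 ?(ltW D1_gt0)//; lra.
have [T1E|T2E] := fixed_node.
  rewrite T1E in F1 F2 gap *; have [T2E|T2Y] := eqVneq T2 Y2.
    by rewrite T2E in F3 F4 *.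
  have {}T2Y : Y2%:~R + 1 <= T2%:~R :> F.
    by apply: stepz; rewrite lt_neqAle eq_sym T2Y.
  set a : F := Y1%:~R in F1 F2 F3 F4 gap a1 a2 c T1Y1 *.
  set b : F := T2%:~R in F3 F4 gap T2Y2 T2Y u1 u2 *.
  split => //.
  (* The multipliers [y2 - a] and [b + 1 - y2] make the contributions of [y2] cancel; what remains
     is a term at [y1] of known sign. *)
  - rewrite -(@pmulr_rle0 _ (y2 - a)); last lra.
    have -> : (y2 - a) * E (a + 1) b (b + 1) = - ((b + 1 - y2) * E a (a + 1) b
        + p1 * ((a + 1 - y1) * (b - y1) * (y2 - y1) * (b + 1 - a))).
      by rewrite !EE; ring.
    rewrite oppr_le0; apply: addr_ge0; first by rewrite mulr_ge0//; lra.
    by rewrite !mulr_ge0//; lra.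
  (* Here both atoms lie in [a, b], since [y2 < Y2 + 1 <= b]. *)
  - rewrite EE; have -> : p1 * ((y1 - a) * (y1 - b) * (y1 - (b + 1)))
      + p2 * ((y2 - a) * (y2 - b) * (y2 - (b + 1)))
      = p1 * ((y1 - a) * (b - y1) * (b + 1 - y1))
      + p2 * ((y2 - a) * (b - y2) * (b + 1 - y2)) by ring.
    by apply: addr_ge0; rewrite !mulr_ge0//; lra.
rewrite T2E in F3 F4 gap *; have [T1E|T1Y] := eqVneq T1 Y1.
  by rewrite T1E in F1 F2 *.
have {}T1Y : T1%:~R + 1 <= Y1%:~R :> F by apply: stepz; rewrite lt_neqAle T1Y.
set a : F := T1%:~R in F1 F2 gap T1Y1 T1Y s1 s2 *.
set b : F := Y2%:~R in F1 F2 F3 F4 gap b1 b2 c T2Y2 *.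
split => //.
(* Here both atoms lie in [a + 1, b + 1], where the cubic is nonpositive. *)
- rewrite -oppr_ge0 EE.
  have -> : - (p1 * ((y1 - a) * (y1 - (a + 1)) * (y1 - (b + 1)))
      + p2 * ((y2 - a) * (y2 - (a + 1)) * (y2 - (b + 1))))
      = p1 * ((y1 - a) * (y1 - (a + 1)) * (b + 1 - y1))
      + p2 * ((y2 - a) * (y2 - (a + 1)) * (b + 1 - y2)) by ring.
  by apply: addr_ge0; rewrite !mulr_ge0//; lra.
(* The same two multipliers cancel the atom [y2] again. *)
- rewrite -(@pmulr_rge0 _ (b + 1 - y2)); last lra.
  have -> : (b + 1 - y2) * E a (a + 1) b = (y2 - a) * (- E (a + 1) b (b + 1))
      + p1 * ((y1 - (a + 1)) * (b - y1) * (y2 - y1) * (b + 1 - a)).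
    by rewrite !EE; ring.
  apply: addr_ge0; first by rewrite mulr_ge0 ?oppr_ge0//; lra.
  by rewrite !mulr_ge0//; lra.
Qed.
End floor_nodes.

(** * Quadrature weights at four nodes *)

Lemma nodes_weights (F : realFieldType) (m1 m2 m3 a b : F)
    (x := nth 0 [:: a; a + 1; b; b + 1]) (E := cubic_moment m1 m2 m3) :
  a + 2 <= b ->
  [/\ E (a + 1) b (b + 1) <= 0, 0 <= E a b (b + 1),
      E a (a + 1) (b + 1) <= 0 & 0 <= E a (a + 1) b] ->
  exists2 w : nat -> F, forall i, 0 <= w i &
    forall k, (k < 4)%N ->
      \sum_(i < 4) w i * x i ^+ k = nth 0 [:: 1; m1; m2; m3] k.
Proof.
move=> ab [E1 E2 E3 E4].
have [d1 d2 d3] : [/\ 0 < b - a, 0 < b - a - 1 & 0 < b - a + 1] by split; lra.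
(* Each weight is the moment functional at the Lagrange basis cubic of its node, the sign of the
   denominator being moved to the numerator. Beyond the four nodes [nth] returns the weight 0. *)
exists (nth 0 [:: - E (a + 1) b (b + 1) / ((b - a) * (b - a + 1));
                  E a b (b + 1) / ((b - a - 1) * (b - a));
                  - E a (a + 1) (b + 1) / ((b - a) * (b - a - 1));
                  E a (a + 1) b / ((b - a + 1) * (b - a))]).
  move=> [|[|[|[|i]]]] /=; rewrite ?nth_nil// divr_ge0 ?oppr_ge0// mulr_ge0//;
    exact: ltW.
have [n1 n2 n3] : [/\ b - a != 0, b - a - 1 != 0 & b - a + 1 != 0].
  by rewrite !gt_eqF.
move=> [|[|[|[|k]]]]// _; rewrite !big_ord_recr big_ord0 /= /x /= /E;
  rewrite /cubic_moment; field; by rewrite n1 n2 n3.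
Qed.

(** * Supports and atoms of probability measures on the line *)

Section measures.
Variable R : realType.
Local Notation T := (measurableTypeR R).
Implicit Types (mu : probability T R) (P : {poly R}).

Lemma aeS mu (A B : set R) : A `<=` B ->
  {ae mu, forall x, A x} -> {ae mu, forall x, B x}.
Proof. by move=> AB; apply: negligibleS; exact: subsetC. Qed.

(** A point outside the support lies in a null open interval with rational endpoints, and there are
    only countably many of these. *)
Lemma supp_ae mu : {ae mu, forall x, supp mu x}.
Proof.
pose I (pq : rat * rat) : set R := `]ratr pq.1, ratr pq.2[%classic.
(* [F] enumerates the null rational intervals; every other index gets [set0]. *)
pose F n : set R := if unpickle n is Some pq then
  (if mu (I pq) == 0%E then I pq else set0) else set0.
have : mu.-negligible (\bigcup_n F n).
  apply: negligible_bigcup => n; rewrite /F.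
  case: unpickle => [pq|]; last exact: negligible_set0.
  case: ifPn => [/eqP I0|_]; last exact: negligible_set0.
  by exists (I pq); split => //; exact: measurable_itv.
apply: negligibleS => x /= /existsNP[U] /not_implyP[oU] /not_implyP[Ux].
move/negP; rewrite -leNgt measure_le0 => /eqP U0.
have [e [e0 /= Ue]] : exists e : R, 0 < e /\ `]x - e, x + e[%classic `<=` U.
  near (0 : R)^'+ => e; exists e; split; first by [].
  by near: e; exact: open_itvoo_subset.
have [p /itvP px] : exists p : rat, ratr p \in `]x - e, x[.
  by apply: rat_in_itvoo; rewrite ltrBlDr ltrDl.
have [q /itvP qx] : exists q : rat, ratr q \in `]x, x + e[.
  by apply: rat_in_itvoo; rewrite ltrDl.
exists (pickle (p, q)); [exact: Logic.I|rewrite /F pickleK].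
have -> : mu (I (p, q)) = 0%E.
  apply: (subset_measure0 _ _ _ U0).
  - exact: measurable_itv.
  - exact: open_measurable.
  - apply: subset_trans Ue => y; rewrite /I /= !in_itv/= => /andP[py yq].
    by rewrite (le_lt_trans _ py) ?(lt_le_trans yq) ?px ?qx.
by rewrite eqxx /I /= in_itv/= px qx.
Unshelve. all: by end_near. Qed.

Lemma ae_closed_supp mu (A : set R) : closed A -> {ae mu, forall x, A x} ->
  supp mu `<=` A.
Proof.
move=> cA muA x sx; apply: contrapT => nAx.
have oA : open (~` A) by exact: closed_openC.
have := sx _ oA nAx; suff -> : mu (~` A) = 0%E by rewrite ltxx.
by apply/negligibleP => //; exact: open_measurable.
Qed.

(** Up to a null set [U] contains at most the point [x], so a null {x} would make the neighbourhood
    [U] null. *)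
Lemma supp_isolated mu x (U : set R) : supp mu x -> open U -> U x ->
  (forall y, supp mu y -> U y -> y = x) -> (0 < mu [set x])%E.
Proof.
move=> sx oU Ux Usx; rewrite lt0e measure_ge0 andbT; apply/eqP => mux0.
have := sx _ oU Ux; suff -> : mu U = 0%E by rewrite ltxx.
apply/negligibleP; first exact: open_measurable.
have nx : mu.-negligible [set x] by exists [set x]; split.
apply: (negligibleS _ (negligibleU nx (supp_ae mu))) => y Uy.
by have [/Usx/(_ Uy)|] := pselect (supp mu y); [left|right].
Qed.

Lemma ae_exists mu (A : set R) : {ae mu, forall x, A x} -> A !=set0.
Proof.
move=> muA; apply/set0P/eqP => A0; move: muA; rewrite A0.
move=> [B [mB B0]]; rewrite setC0 => TB.
have := probability_setT mu; rewrite (_ : setT = B).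
  by rewrite B0 => /eqP; rewrite eq_sym onee_eq0.
by apply/seteqP; split.
Qed.

(** Half-lines separate the two points, which are thus atoms; almost everywhere [f] is a combination
    of their indicators. *)
Lemma integral_supp2 mu (y1 y2 : R) : y1 < y2 -> supp mu = [set y1; y2] ->
  exists p1 p2 : R, [/\ 0 < p1, 0 < p2, p1 + p2 = 1 &
    forall f : T -> R, measurable_fun setT f ->
      (\int[mu]_x (f x)%:E = (p1 * f y1 + p2 * f y2)%:E)%E].
Proof.
move=> y12 smu.
have fin x : mu [set x] \is a fin_num by exact: fin_num_measure.
have p1 : (0 < mu [set y1])%E.
  apply: (@supp_isolated _ _ `]-oo, y2[%classic).
  - by rewrite smu; left.
  - exact: interval_open.
  - by rewrite /= in_itv.
  - by rewrite smu => y [->|->]//=; rewrite in_itv/= ltxx.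
have p2 : (0 < mu [set y2])%E.
  apply: (@supp_isolated _ _ `]y1, +oo[%classic).
  - by rewrite smu; right.
  - exact: interval_open.
  - by rewrite /= in_itv/= y12.
  - by rewrite smu => y [->|->]//=; rewrite in_itv/= ltxx.
have If (f : T -> R) : measurable_fun setT f -> (\int[mu]_x (f x)%:E =
    (fine (mu [set y1]) * f y1 + fine (mu [set y2]) * f y2)%:E)%E.
  move=> mf.
  pose g := fun x : T => ((f y1)%:E * (\1_[set y1] x)%:E +
                          (f y2)%:E * (\1_[set y2] x)%:E)%E.
  have ig y :
      mu.-integrable setT (fun x : T => ((f y)%:E * (\1_[set y] x)%:E)%E).
    by apply: integrableZl => //; exact: integrable_indic.
  have -> : (\int[mu]_x (f x)%:E = \int[mu]_x g x)%E.
    apply: ae_eq_integral => //.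
    - exact/measurable_EFinP.
    - exact: (measurable_int mu (integrableD measurableT (ig y1) (ig y2))).
    - apply: aeS (supp_ae mu) => x; rewrite smu => -[->|->] _;
        rewrite /g !indicE.
      + rewrite mem_set//= memNset ?mule1 ?mule0 ?adde0//=.
        by move=> e; rewrite e ltxx in y12.
      + rewrite memNset/= ?mem_set//= ?mule1 ?mule0 ?add0e//=.
        by move=> e; rewrite e ltxx in y12.
  rewrite integralD// !integralZl//; try exact: integrable_indic.
  rewrite !integral_indic// !setIT EFinD !EFinM !fineK//.
  by rewrite ![(_%:E * mu _)%E]muleC.
exists (fine (mu [set y1])), (fine (mu [set y2])); split => //.
- by rewrite fine_gt0// p1 ltey_eq fin.
- by rewrite fine_gt0// p2 ltey_eq fin.
- have := If (cst 1) (measurable_cst _); rewrite /= !mulr1 integral_cst// mul1e.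
  by rewrite [X in X = _](probability_setT mu) => -[].
Qed.

(** * Integrals of polynomials and finite sums of Dirac measures *)

Lemma realizes_poly (X : set R) mu n (m : n.-tuple R) P :
  realizes X mu m -> (size P <= n.+1)%N ->
  mu.-integrable setT (fun x : T => P.[x]%:E) /\
  (\int[mu]_x P.[x]%:E = (Defs.Lfun P m)%:E)%E.
Proof.
move=> [_ rm] sP.
have im (k : 'I_n.+1) : mu.-integrable setT (fun x : T => (x ^+ k)%:E) /\
    (\int[mu]_x (x ^+ k)%:E = (mom m k)%:E)%E.
  (* Index 0 stands for the total mass 1, the others for the entries of [m]. *)
  case: (unliftP ord0 k) => [j ->|->].
    have [i1 i2] := rm j; split; first by [].
    by rewrite i2 /mom /= (tnth_nth 0).
  split; first exact: finite_measure_integrable_cst.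
  rewrite -[LHS]/(\int[mu]_x (cst 1%:E x))%E integral_cst// mul1e.
  exact: probability_setT.
have PE : (fun x : T => P.[x]%:E) =
    (fun x : T => \sum_(k < n.+1) ((P`_k)%:E * (x ^+ k)%:E))%E.
  apply/funext => x; rewrite (horner_coef_wide _ sP) -sumEFin.
  by under eq_bigr do rewrite EFinM.
have ik (k : 'I_n.+1) :
    mu.-integrable setT (fun x : T => ((P`_k)%:E * (x ^+ k)%:E)%E).
  by apply: integrableZl => //; exact: (im k).1.
rewrite PE; split; first exact: integrable_sum.
rewrite integral_sum// /Defs.Lfun -sumEFin.
by apply: eq_bigr => k _; rewrite integralZl//;
  [rewrite (im k).2|exact: (im k).1].
Qed.

Lemma finite_convex_dirac (n : nat) (w a : nat -> R) :
  (forall i, 0 <= w i) -> \sum_(i < n) w i = 1 ->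
  exists mu, {ae mu, forall x, exists2 i, (i < n)%N & x = a i} /\
    forall f : T -> R, measurable_fun setT f ->
      mu.-integrable setT (EFin \o f) /\
      (\int[mu]_x (f x)%:E = (\sum_(i < n) w i * f (a i))%:E)%E.
Proof.
move=> w0 w1.
pose d (i : nat) : {measure set T -> \bar R} :=
  mscale (NngNum (w0 i)) (@dirac _ T (a i) R).
pose s : {measure set T -> \bar R} := msum d n.
have sE A : s A = (\sum_(i < n) (w i)%:E * ((a i \in A)%:R)%:E)%E.
  by rewrite /s /= /msum; apply: eq_bigr => i _; rewrite /d/= /mscale/= diracE.
have sT : s setT = 1%E.
  rewrite sE -[RHS](congr1 EFin w1) -sumEFin; apply: eq_bigr => i _.
  by rewrite in_setT -EFinM mulr1.
(* [mnormalize] supplies the probability structure; since the weights sum to 1, it leaves [s]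
   unchanged. *)
pose mu : probability T R := mnormalize s (@dirac _ T (a 0%N) R).
have muE : mu = s :> (set T -> \bar R).
  by apply/funext => A; rewrite /mu/= /mnormalize sT onee_eq0/= invr1 mule1.
exists mu.
have I0 (f : T -> \bar R) : measurable_fun setT f -> (forall x, 0 <= f x)%E ->
    (\int[mu]_x f x = \sum_(i < n) (w i)%:E * f (a i))%E.
  move=> mf f0; rewrite muE [LHS](ge0_integral_measure_sum d)//.
  apply: eq_bigr => i _; rewrite ge0_integral_mscale//= integral_dirac//=.
  by rewrite diracT mul1e.
split.
  pose A : set R := [set x | exists2 i, (i < n)%N & x = a i].
  exists (~` A); split => //.
    apply: measurableC; rewrite (_ : A = \bigcup_(i < n) [set a i]).
      by apply: bigcup_measurable => i _; exact: measurable_set1.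
    by apply/seteqP; split => x [i in_ xi]; exists i.
  rewrite muE sE big1// => i _; rewrite memNset; first by rewrite -EFinM mulr0.
  by apply; exists i.
move=> f mf; split.
  apply/integrableP; split; first exact/measurable_EFinP.
  rewrite I0//; last by apply: measurableT_comp => //; exact/measurable_EFinP.
  by under eq_bigr do rewrite /= -EFinM; rewrite sumEFin ltry.
have mF : measurable_fun setT (EFin \o f) by exact/measurable_EFinP.
rewrite integralE !I0//; [|exact: measurable_funeneg|exact: measurable_funepos].
under eq_bigr do rewrite funeposE/= -EFin_max -EFinM.
under [X in (_ - X)%E]eq_bigr do rewrite funenegE/= -EFin_max -EFinM.
rewrite !sumEFin -EFinB -sumrB; congr (_%:E); apply: eq_bigr => i _.
rewrite -mulrBr; congr (_ * _).
have [h|/ltW h] := leP 0 (f (a i)).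
  by rewrite max_r ?oppr_le0// subr0.
by rewrite max_l ?oppr_ge0// sub0r opprK.
Qed.

(** Points are picked in turn outside the pair formed by the earlier ones; the degenerate pair
    [u = v] serves for the second point. *)
Lemma card_ge3 (A : set R) : A !=set0 ->
  (forall u v, A u -> A v -> ~ (A `<=` [set u; v])) -> (`I_3 #<= A)%card.
Proof.
move=> [x Ax] nA.
have [y /not_implyP[Ay /= xy]] : exists y, ~ (A y -> [set x; x] y).
  by apply/existsNP/nA.
have [z /not_implyP[Az /= xyz]] : exists z, ~ (A z -> [set x; y] z).
  by apply/existsNP/nA.
have [yx zx zy] : [/\ y <> x, z <> x & z <> y].
  split; first by move=> yx; apply: xy; left.
  - by move=> zx; apply: xyz; left.
  - by move=> zx; apply: xyz; right.
pose f i := nth x [:: x; y; z] i.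
have fi : {in `I_3 &, injective f}.
  move=> i j /set_mem /= + /set_mem /=.
  by case: i j => [|[|[|?]]]// [|[|[|?]]]// _ _; rewrite /f/=; congruence.
rewrite -(card_le_eql (inj_card_eq fi)); apply: subset_card_le.
by move=> _ [[|[|[|?]]]//= _ <-].
Qed.

(** Nonnegativity holds only almost everywhere; the absolute value makes the integrand nonnegative
    everywhere, the form used for [integral_ge0] and the vanishing criterion. *)
Lemma integral_poly_abs mu P : {ae mu, forall x, 0 <= P.[x]} ->
  (\int[mu]_x P.[x]%:E = \int[mu]_x `|P.[x]%:E|)%E.
Proof.
have mP : measurable_fun setT (fun x : T => P.[x]%:E).
  by apply/measurable_EFinP; exact: measurable_poly.
move=> P0; apply: ae_eq_integral => //; first exact: measurableT_comp.
by apply: aeS P0 => x P0 _; rewrite gee0_abs// lee_fin.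
Qed.

Lemma integral_poly_eq0 mu P : {ae mu, forall x, 0 <= P.[x]} ->
  (\int[mu]_x P.[x]%:E = 0)%E <-> {ae mu, forall x, P.[x] = 0}.
Proof.
have mP : measurable_fun setT (fun x : T => P.[x]%:E).
  by apply/measurable_EFinP; exact: measurable_poly.
move=> P0; rewrite integral_poly_abs//.
apply: (iff_trans (ae_eq_integral_abs mu measurableT mP)).
split; apply: aeS => x; first by move=> /(_ Logic.I)[].
by move=> -> _.
Qed.

Lemma integral_poly_ae0 mu P : {ae mu, forall x, P.[x] = 0} ->
  (\int[mu]_x P.[x]%:E = 0)%E.
Proof.
by move=> P0; apply/integral_poly_eq0 => //; apply: aeS P0 => x /= ->.
Qed.

Lemma closed_root P : closed [set x : R | root P x].
Proof.
have -> : [set x | root P x] = horner P @^-1` [set 0].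
  by apply/seteqP; split => x /= /rootP.
by apply: closed_comp; [move=> x _; exact: continuous_horner|exact: closed_eq].
Qed.

Lemma realizes_prefix (X : set R) mu (m1 m2 m3 m4 : R) :
  realizes X mu [tuple m1; m2; m3; m4] -> realizes X mu [tuple m1; m2; m3].
Proof.
move=> [aX rm]; split=> // k; have := rm (widen_ord (leqnSn 3) k).
by rewrite !(tnth_nth 0) /=; case: k => -[|[|[|]]].
Qed.

(** For monic quartics a change of the last moment shifts all values equally, so comparing them does
    not depend on it. *)
Lemma Lfun_last (m1 m2 m3 m4 m4' : R) P :
  Defs.Lfun P [tuple m1; m2; m3; m4]
  = Defs.Lfun P [tuple m1; m2; m3; m4'] + P`_4 * (m4 - m4').
Proof. by rewrite /Defs.Lfun !big_ord_recr !big_ord0 /= /mom/=; ring. Qed.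

(** * Test polynomials with consecutive integer roots *)

Lemma calP_prod (s : seq nat) : uniq s ->
  let P := \prod_(a <- s) ('X - (a%:R)%:P) : {poly R} in
  (forall j : nat, 0 <= P.[j%:R]) -> calP (size s) P.
Proof.
move=> us P P0; split=> //.
- by rewrite /P monic_prod_XsubC.
- by rewrite /P size_prod_XsubC.
- exists s; split=> //; apply/allP => a as_.
  rewrite /P -(big_map (fun b : nat => b%:R) predT (fun x => 'X - x%:P)).
  by rewrite root_prod_XsubC map_f.
Qed.

(** No natural number lies strictly between k and k + 1. *)
Lemma consecutive_ge0 (j k : nat) : 0 <= (j%:R - k%:R) * (j%:R - k.+1%:R) :> R.
Proof.
have [jk|kj] := leqP j k.
  by rewrite mulr_le0// subr_le0 ler_nat// leqW.
by rewrite mulr_ge0// subr_ge0 ler_nat// ltnW.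
Qed.

(** I-realizability applied to this quadratic makes the denominators of [t1] and [t2] positive. *)
Lemma calP2 (k : nat) :
  calP 2 (('X - (k%:R)%:P) * ('X - (k.+1%:R)%:P) : {poly R}).
Proof.
have := @calP_prod [:: k; k.+1]; rewrite !big_cons big_nil mulr1; apply.
  by rewrite /= inE neq_ltn ltnSn.
by move=> j; rewrite !hornerE/= consecutive_ge0.
Qed.

(** At [k = Y2] the moment of this cubic is the numerator of [t1]; a positive k keeps the root 0
    distinct from the others. *)
Lemma calP3 (k : nat) : (0 < k)%N ->
  calP 3 ('X * (('X - (k%:R)%:P) * ('X - (k.+1%:R)%:P)) : {poly R}).
Proof.
move=> k0; have := @calP_prod [:: 0; k; k.+1]%N.
rewrite !big_cons big_nil mulr1 subr0; apply.
  by rewrite /= !inE; lia.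
by move=> j; rewrite !hornerE/= -[leRHS]mulrA mulr_ge0// consecutive_ge0.
Qed.

Lemma calP4 (a b : nat) : (a.+1 < b)%N ->
  calP 4 (('X - (a%:R)%:P) * ('X - (a.+1%:R)%:P)
          * ('X - (b%:R)%:P) * ('X - (b.+1%:R)%:P) : {poly R}).
Proof.
move=> ab; have := @calP_prod [:: a; a.+1; b; b.+1].
rewrite !big_cons big_nil mulr1 !mulrA; apply.
  by rewrite /= !inE; lia.
by move=> j; rewrite !hornerE/= -[leRHS]mulrA mulr_ge0// consecutive_ge0.
Qed.

Definition node_poly (a b : nat) : {poly R} :=
  ('X - (a%:R)%:P) * ('X - (a.+1%:R)%:P)
  * ('X - (b%:R)%:P) * ('X - (b.+1%:R)%:P).

Lemma calP_ae_ge0 mu k P : {ae mu, forall x, N0 x} -> calP k P ->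
  {ae mu, forall x, 0 <= P.[x]}.
Proof. by move=> muN [_ _ _ P0]; apply: aeS muN => _ [j ->]; exact: P0. Qed.

Lemma calP4_coef P : calP 4 P -> (size P <= 5)%N /\ P`_4 = 1.
Proof. by move=> [/monicP + sP _ _]; rewrite /lead_coef sP. Qed.

(** * The measure at the smallest fourth moment *)

Section extremal.
Variables (m1 m2 m3 tm4 : R) (mu : probability T R) (a b : nat).
Local Notation E := (cubic_moment m1 m2 m3).
Hypothesis tm4P : is_smallest [set x | realizable N0 [tuple m1; m2; m3; x]] tm4.
Hypothesis muP : realizes N0 mu [tuple m1; m2; m3; tm4].
Hypothesis ab : (a.+1 < b)%N.
Hypothesis signE :
  [/\ E a.+1%:R b%:R b.+1%:R <= 0, 0 <= E a%:R b%:R b.+1%:R,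
      E a%:R a.+1%:R b.+1%:R <= 0 & 0 <= E a%:R a.+1%:R b%:R].
Local Notation Q := (node_poly a b).

(* The competitor that matches [m1], [m2], [m3] and lives on the roots of [Q]
   witnesses that no measure on [N0] with these moments has positive [Q]-mass
   at the smallest fourth moment. *)
Lemma extremal_ae_root : {ae mu, forall x, root Q x}.
Proof.
have natS (k : nat) : k.+1%:R = k%:R + 1 :> R by rewrite -natr1.
have [] := @nodes_weights R m1 m2 m3 a%:R b%:R.
- by rewrite -natrD ler_nat; lia.
- by rewrite -!natS.
rewrite -!natS => w w0 wm.
pose z : nat -> R := nth 0 [:: a%:R; a.+1%:R; b%:R; b.+1%:R].
have w1 : \sum_(i < 4) w i = 1.
  by rewrite -[RHS](wm 0%N)//; apply: eq_bigr => i _; rewrite expr0 mulr1.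
have [s [s_ae sI]] := finite_convex_dirac z w0 w1.
pose m4 := \sum_(i < 4) w i * z i ^+ 4.
have sP : realizes N0 s [tuple m1; m2; m3; m4].
  split.
    apply: aeS s_ae => _ [[|[|[|[|//]]]] _ ->]; rewrite /z/=;
      [by exists a|by exists a.+1|by exists b|by exists b.+1].
  move=> k; have [] := sI (fun x => x ^+ k.+1); first exact: measurable_funX.
  move=> i1 i2; split=> //; rewrite i2 (tnth_nth 0); congr (_%:E).
  case: k {i1 i2} => -[|[|[|[|//]]]] ? /=; [exact: wm 1%N _|exact: wm 2%N _|
    exact: wm 3%N _|by []].
have tm4_le : tm4 <= m4 by apply: tm4P.2; exists s.
have QP := calP4 ab; have [sQ Q4] := calP4_coef QP.
have Q0 := calP_ae_ge0 muP.1 QP.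
have sQ0 : Defs.Lfun Q [tuple m1; m2; m3; m4] = 0.
  have [_] := realizes_poly sP sQ; rewrite integral_poly_ae0 => [[<-]//|].
  apply: aeS s_ae => _ [[|[|[|[|//]]]] _ ->]; rewrite /z /node_poly /= !hornerE
    subrr ?(mulr0, mul0r)//.
have [_ muQ] := realizes_poly muP sQ.
(* As [Q] is monic and integrates to 0 against [s], its integral against [mu] is [tm4 - m4], at most
   0 by minimality; it is also nonnegative, since [mu] lives on the naturals. *)
have : {ae mu, forall x, Q.[x] = 0}; last by apply: aeS => x /rootP.
apply/integral_poly_eq0 => //; apply/eqP; rewrite eq_le; apply/andP; split.
  rewrite muQ (Lfun_last _ _ _ _ m4) sQ0 Q4 mul1r add0r lee_fin.
  by rewrite subr_le0.
by rewrite integral_poly_abs//; exact: integral_ge0.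
Qed.

(** After passing to [tm4] both values are integrals against [mu]: that of [Q] is 0, that of any
    competitor is nonnegative. *)
Lemma extremal_minimizing m4 : minimizing_poly [tuple m1; m2; m3; m4] Q.
Proof.
have QP := calP4 ab; have [sQ Q4] := calP4_coef QP.
split=> // P PP; have [sP P4] := calP4_coef PP.
rewrite !(Lfun_last _ _ _ m4 tm4) Q4 P4 lerD2r.
rewrite -lee_fin -(realizes_poly muP sQ).2 -(realizes_poly muP sP).2.
rewrite integral_poly_ae0; last by apply: aeS extremal_ae_root => x /rootP.
rewrite integral_poly_abs; first exact: integral_ge0.
exact: calP_ae_ge0 muP.1 PP.
Qed.

(** The root set of [Q] is closed and carries [mu], so it contains the support. *)
Lemma extremal_supp :
  supp mu `<=` [set x | x \in [:: a%:R; a.+1%:R; b%:R; b.+1%:R]].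
Proof.
move=> x /(ae_closed_supp (@closed_root Q) extremal_ae_root) /=.
by rewrite /node_poly !rootM !root_XsubC !inE -!orbA.
Qed.

End extremal.
End measures.

(** * From the two atoms of [nu] to the nodes of [mu] *)

Theorem theorem6p8 (R : realType) (m1 m2 m3 hm4 tm4 y1 y2 : R)
    (nu mu : probability (measurableTypeR R) R)
    (hI : I_realizable [tuple m1; m2; m3])
    (hhm4 : is_smallest [set x | psd (hankel 2 [tuple m1; m2; m3; x])] hm4)
    (hnu : realizes Rplus nu [tuple m1; m2; m3; hm4])
    (hy : y1 < y2)
    (hsupp : supp nu = [set y1; y2])
    (htm4 : is_smallest [set x | realizable N0 [tuple m1; m2; m3; x]] tm4)
    (hmu : realizes N0 mu [tuple m1; m2; m3; tm4])
    (hnN0 : ~ (supp nu `<=` N0)) :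
  let Y1 : R := (Num.floor y1)%:~R in
  let Y2 : R := (Num.floor y2)%:~R in
  let t1 : R := (m3 - (2 * Y2 + 1) * m2 + Y2 * (Y2 + 1) * m1)
                / (m2 - (2 * Y2 + 1) * m1 + Y2 * (Y2 + 1)) in
  let t2 : R := (m3 - (2 * Y1 + 1) * m2 + Y1 * (Y1 + 1) * m1)
                / (m2 - (2 * Y1 + 1) * m1 + Y1 * (Y1 + 1)) in
  let T1 : R := (Num.floor t1)%:~R in
  let T2 : R := (Num.floor t2)%:~R in
  [/\ supp mu `<=` [set T1; T1 + 1; T2; T2 + 1],
      (`I_3 #<= supp mu)%card,
      T1 + 1 <= T2,
      T1 + 1 < T2 ->
        forall m4 : R, minimizing_poly [tuple m1; m2; m3; m4]
          (('X - T1%:P) * ('X - (T1 + 1)%:P)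
           * ('X - T2%:P) * ('X - (T2 + 1)%:P))
    & T2 = T1 + 1 ->
        forall m4 : R, minimizing_poly [tuple m1; m2; m3; m4]
          (('X - T1%:P) * ('X - T2%:P)
           * ('X - (T2 + 1)%:P) * ('X - (T2 + 2)%:P))].
Proof.
move=> Y1 Y2 t1 t2 T1 T2.
have [p1 [p2 [p1_gt0 p2_gt0 p12 nuI]]] := integral_supp2 hy hsupp.
have hnu3 := realizes_prefix hnu.
have LfunE (P : {poly R}) : (size P <= 4)%N ->
    Defs.Lfun P [tuple m1; m2; m3] = p1 * P.[y1] + p2 * P.[y2].
  move=> sP; have [_] := realizes_poly hnu3 sP.
  by rewrite nuI; [case|exact: measurable_poly].
have momE (k : 'I_3) :
    tnth [tuple m1; m2; m3] k = p1 * y1 ^+ k.+1 + p2 * y2 ^+ k.+1.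
  have [_] := hnu3.2 k.
  by rewrite nuI; [case|exact: measurable_funX].
have m1E : m1 = p1 * y1 + p2 * y2 := momE (@Ordinal 3 0 isT).
have m2E : m2 = p1 * y1 ^+ 2 + p2 * y2 ^+ 2 := momE (@Ordinal 3 1 isT).
have m3E : m3 = p1 * y1 ^+ 3 + p2 * y2 ^+ 3 := momE (@Ordinal 3 2 isT).
have p2E : p2 = 1 - p1 by rewrite -p12 addrC addKr.
have quad_gt0 (k : nat) : 0 < m2 - (2 * k%:R + 1) * m1 + k%:R * (k%:R + 1).
  have P2 := @calP2 R k; have [_ sP _ _] := P2.
  have := hI.2 _ (or_intror P2); rewrite LfunE ?sP// !hornerE /= -natr1.
  move=> /lt_le_trans; apply; rewrite le_eqVlt; apply/orP; left; apply/eqP.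
  by rewrite m1E m2E p2E; ring.
have cubic_gt0 (k : nat) : (0 < k)%N ->
    0 < m3 - (2 * k%:R + 1) * m2 + k%:R * (k%:R + 1) * m1.
  move=> k0; have P3 := @calP3 R k k0; have [_ sP _ _] := P3.
  have := hI.2 _ (or_introl P3); rewrite LfunE ?sP// !hornerE /= -natr1.
  move=> /lt_le_trans; apply; rewrite le_eqVlt; apply/orP; left; apply/eqP.
  by rewrite m1E m2E m3E; ring.
(* The closed half-line contains the support of [nu], so the floors of both atoms are naturals, as
   the test polynomials require. *)
have y_ge0 y : supp nu y -> 0 <= y.
  by move=> sy; have := ae_closed_supp (@closed_ge R 0) hnu.1 sy.
have natfloor (x : R) : 0 <= x -> exists k : nat, Num.floor x = k.
  by rewrite -floor_ge0; case: (Num.floor x) => // k _; exists k.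
have floorP (x : R) : (Num.floor x)%:~R <= x < (Num.floor x)%:~R + 1.
  by have := floorD1_gt x; rewrite floor_le intrD.
have [k1 k1E] := natfloor _ (y_ge0 y1 ltac:(by rewrite hsupp; left)).
have [k2 k2E] := natfloor _ (y_ge0 y2 ltac:(by rewrite hsupp; right)).
have D1 : 0 < m2 - (2 * Y1 + 1) * m1 + Y1 * (Y1 + 1).
  by rewrite /Y1 k1E; exact: quad_gt0.
have D2 : 0 < m2 - (2 * Y2 + 1) * m1 + Y2 * (Y2 + 1).
  by rewrite /Y2 k2E; exact: quad_gt0.
have sep := floor_nodes_sep p1_gt0 p2_gt0 p12 hy m1E m2E
  (floorP y1) (floorP y2) D1.
have t1E : t1 * (m2 - (2 * Y2 + 1) * m1 + Y2 * (Y2 + 1))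
    = m3 - (2 * Y2 + 1) * m2 + Y2 * (Y2 + 1) * m1 by rewrite divfK ?gt_eqF.
have t2E : t2 * (m2 - (2 * Y1 + 1) * m1 + Y1 * (Y1 + 1))
    = m3 - (2 * Y1 + 1) * m2 + Y1 * (Y1 + 1) * m1 by rewrite divfK ?gt_eqF.
have gap := floor_nodes_gap p1_gt0 p2_gt0 p12 hy m1E m2E m3E
  (floorP y1) (floorP y2) (floorP t1) (floorP t2) D1 D2 t1E t2E.
have sgn := floor_nodes_sign p1_gt0 p2_gt0 p12 hy m1E m2E m3E
  (floorP y1) (floorP y2) (floorP t1) (floorP t2) D1 D2 t1E t2E.
(* [t1] is a quotient of positive moments; the numerator comes from a cubic of [calP 3] because
   [Y2 >= Y1 + 1 >= 1]. *)
have [a aE] : exists a : nat, Num.floor t1 = a.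
  apply: natfloor; rewrite divr_ge0 ?(ltW D2)// /Y2 k2E ltW// cubic_gt0//.
  by move: sep; rewrite k1E k2E natr1 ler_nat; exact: leq_trans.
have [b bE] : exists b : nat, Num.floor t2 = b.
  apply: natfloor; have [_ /andP[t2T _]] := (floorP t1, floorP t2).
  apply: le_trans t2T; apply: le_trans gap; rewrite aE; exact: addr_ge0.
have {}aE : T1 = a%:R by rewrite /T1 aE.
have {}bE : T2 = b%:R by rewrite /T2 bE.
have T1S : T1 + 1 = a.+1%:R by rewrite aE natr1.
have T2S : T2 + 1 = b.+1%:R by rewrite bE natr1.
rewrite -/T1 -/T2 T1S T2S aE bE in gap sgn *.
have ab : (a.+1 < b)%N by move: gap; rewrite -natrD ler_nat addn2.
have nodes := extremal_supp htm4 hmu ab sgn.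
split.
- move=> x /nodes /=; rewrite !inE => /or4P[] /eqP ->;
    [by left; left; left|by left; left; right|by left; right|by right].
- apply: card_ge3; first exact: ae_exists (supp_ae mu).
  move=> u v su sv uv; apply: hnN0.
  have suppN0 x : supp mu x -> N0 x.
    by move=> /nodes /=; rewrite !inE => /or4P[] /eqP ->; eexists.
  (* The cubic with roots [u], [v], [z] vanishes almost everywhere for [mu], and [nu] has the same
     first three moments, so its integral against [nu] is 0 as well. *)
  have key (z : R) : p1 * ((y1 - u) * (y1 - v) * (y1 - z))
      + p2 * ((y2 - u) * (y2 - v) * (y2 - z)) = 0.
    pose P := \prod_(x <- [:: u; v; z]) ('X - x%:P).
    have PE x : P.[x] = (x - u) * (x - v) * (x - z).
      by rewrite /P !big_cons big_nil !hornerE/= ?mulr1 ?mulrA; ring.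
    have sP : (size P <= 4)%N by rewrite size_prod_XsubC.
    have := LfunE P sP.
    have [_] := realizes_poly (realizes_prefix hmu) sP.
    rewrite integral_poly_ae0 => [[<-]|].
      by rewrite !PE.
    by apply: aeS (supp_ae mu) => x /uv; rewrite PE => -[->|->];
      rewrite subrr ?(mul0r, mulr0).
  (* Taking for [z] the other atom of [nu] leaves a single term, which forces [y] to be [u] or [v],
     both natural. *)
  have atom (y z p : R) : 0 < p -> y != z ->
      p * ((y - u) * (y - v) * (y - z)) = 0 -> N0 y.
    move=> p0 yz /eqP; rewrite !mulf_eq0 gt_eqF//= !subr_eq0 (negbTE yz) orbF.
    by move=> /orP[] /eqP ->; exact: suppN0.
  rewrite hsupp => _ [->|->].
    apply: (atom y1 y2 p1) => //; first by rewrite lt_eqF.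
    by have := key y2; rewrite subrr !mulr0 addr0.
  apply: (atom y2 y1 p2) => //; first by rewrite gt_eqF.
  by have := key y1; rewrite subrr !mulr0 add0r.
- by rewrite ler_nat ltnW.
- by move=> _ m4; exact: (extremal_minimizing htm4 hmu ab sgn m4).
(* The strict gap [a.+1 < b] rules this case out. *)
- by move/eqP; rewrite eqr_nat (gtn_eqF ab).
Qed.
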